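(* For every odd integer $t\ge 3$, there exists an $R_t$-type strategy.
   Context: Two-player Levine hat game with infinite stacks: players A and B have stacks $U=(U^{(k)})_{k\ge1}$ and $V=(V^{(k)})_{k\ge1}$, all entries being independent Bernoulli$(1/2)$ variables ($1$ = black, $0$ = white). Each player sees only the other player's stack and names an index in $\{1,2,3,\dots\}$. If A uses the (measurable) strategy $K_1$ and B uses $K_2$, the players win if and only if $U^{(K_1(V))}=1$ and $V^{(K_2(U))}=1$. A $t$-strategy for one player is a function $\{0,1\}^t\to\{1,\dots,t\}$. Let $\mathcal C_t\subset\{0,1\}^t$ be the set of non-monochromatic $t$-tuples, i.e. all $t$-tuples except $(0,\dots,0)$ and $(1,\dots,1)$. Given a $t$-strategy $k$, the associated recursive strategy $K$ is: cut the observed infinite stack into consecutive blocks of $t$ hats, skip the monochromatic blocks, and upon reaching the first non-monochromatic block $u$, after $m\ge0$ skipped blocks, return $mt+k(u)$ (almost surely such a block exists; otherwise the value is arbitrary). For $t\ge3$, an $R_t$-type strategy is a pair $(K_1,K_2)$ of strategies for the two players, where $K_1$ and $K_2$ are the recursive strategies associated in this way with $t$-strategies $k_1$ and $k_2$ (not necessarily equal), such that the probability of victory when A uses $K_1$ and B uses $K_2$ is exactly $7/20$. *)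

(* Defs.v *)
From HB Require Import structures.
From mathcomp Require Import all_boot all_order all_algebra.
From mathcomp Require Import all_classical all_reals all_analysis.

Set Implicit Arguments.
Unset Strict Implicit.
Unset Printing Implicit Defensive.
Import Order.TTheory GRing.Theory Num.Theory.

Local Open Scope classical_set_scope.
Local Open Scope ring_scope.

(* All indices are shifted down by one: the hat with index n.+1 in the usual
   numbering 1, 2, 3, ... is [s n], and a player naming the index n.+1 returns
   [n]. The hat colours are [true] for black and [false] for white. *)
Definition stack : Type := nat -> bool.

Definition cylinder : set (set stack) :=
  [set C | exists n b, C = [set s : stack | s n = b]].

Definition strategy : Type := stack -> nat.

Definition measurable_strategy (K : strategy) : Prop :=
  measurable_fun [set: g_sigma_algebraType cylinder]
    (K : g_sigma_algebraType cylinder -> nat).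

Definition tstrategy (t : nat) : Type := t.-tuple bool -> 'I_t.

Definition monochromatic (t : nat) (u : t.-tuple bool) : bool :=
  (u == [tuple of nseq t false]) || (u == [tuple of nseq t true]).

Definition block (t : nat) (s : stack) (m : nat) : t.-tuple bool :=
  [tuple s (m * t + i)%N | i < t].

(* [K] is unconstrained on the (almost surely avoided) stacks all of whose
   blocks are monochromatic. In shifted indices the answer m * t + k(u) keeps
   the same form. *)
Definition recursive_strategy (t : nat) (k : tstrategy t) (K : strategy)
  : Prop :=
  forall (s : stack) (m : nat),
    (forall j, (j < m)%N -> monochromatic (block t s j)) ->
    ~~ monochromatic (block t s m) ->
    K s = (m * t + k (block t s m))%N.

Section hat_game.
Context {d : measure_display} {Om : measurableType d} {R : realType}.
Variable P : probability Om R.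

Definition mutually_independent (d' : measure_display)
    (E : measurableType d') (I : eqType) (X : I -> {RV P >-> E}) : Prop :=
  forall (J : seq I) (A : I -> set E), uniq J ->
    (forall i, i \in J -> measurable (A i)) ->
    (P (\bigcap_(i in [set` J]) (X i @^-1` A i))
     = \prod_(i <- J) P (X i @^-1` A i))%E.

Definition fair_hats (U V : nat -> {RV P >-> bool}) : Prop :=
  let hat (i : nat + nat) := match i with inl n => U n | inr n => V n end in
  mutually_independent hat /\
  (forall i (B : set bool), distribution P (hat i) B = bernoulli_prob 2^-1 B).

Definition victory (U V : nat -> {RV P >-> bool}) (K1 K2 : strategy)
  : set Om :=
  [set w | U (K1 (fun n => V n w)) w = true /\
           V (K2 (fun n => U n w)) w = true].

End hat_game.

(* The probability of victory depends only on the joint law of the hats, so it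
   is required to take the value 7/20 on every space carrying fair hats. *)
Definition R_type (R : realType) (t : nat) (K1 K2 : strategy) : Prop :=
  [/\ measurable_strategy K1, measurable_strategy K2,
      exists k1 k2 : tstrategy t,
        recursive_strategy k1 K1 /\ recursive_strategy k2 K2 &
      forall (d : measure_display) (Om : measurableType d)
        (P : probability Om R) (U V : nat -> {RV P >-> bool}),
        fair_hats U V -> P (victory U V K1 K2) = (7 / 20)%:E].

(* Main.v *)
Require Import Defs.
From mathcomp Require Import all_boot all_order all_algebra.
From mathcomp Require Import all_classical all_reals all_analysis.
From mathcomp Require Import ring lra zify.

(** Cutting the stacks into blocks of [t] hats turns the infinite game into a
    finite one. Let [w t] be the probability that two [t]-strategies, applied
    to stacks of [t] hats, both name a black hat, and put [d := 2^-t].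

    The engine is [win_prob_splice]. Two strategies on [t] hats are combined
    with two strategies on [1 + s] hats: a player who sees a mixed block of [t]
    hats, one with both colours, plays the first strategy on it; a player who
    sees a monochromatic block merges it into the single hat that is its colour, and plays the
    second strategy on this hat and the [s] hats that follow. If exactly one of
    the two first blocks is mixed, victory has conditional probability 1/4
    whatever the strategies are: the player who sees the mixed block names a
    hat of a monochromatic block, of a fair colour; given that colour, the hat
    named by the other player belongs to a stack that starts with a mixed block
    and is black with probability 1/2, by black-white symmetry. So the
    combination only changes what happens when both blocks are monochromatic,
    an event of probability [4 * d^2] on which the [t]-hat game is won with
    probability 1/4 and the combined one with the probability [w'] of the
    second game:
    [w (t + s) = w t + d^2 * (4 * w' - 1)].

    This identity is used twice. With the optimal strategies on 3 hats, which
    win with probability 22/64 ([win_prob3]), it leads from [t] to [t + 2], and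
    an induction on odd [t] starting at [t = 1] gives strategies with
    [w t = 7/20 - 2/5 * d^2] ([odd_strategies]). With the second game equal to
    the combined game itself, played on the hats after the block, it
    describes the recursive strategy truncated after [n] blocks; its winning
    probability [f n] satisfies [f n.+1 = w t + d^2 * (4 * f n - 1)], whose
    fixed point for this value of [w t] is 7/20 ([win_prob_truncated]).

    The truncated and the full recursive strategies differ only if the first
    [n] blocks of one of the two stacks are all monochromatic, which has
    probability at most [2 * (2 * d)^n] ([victory_approx]). Letting [n] tend to
    infinity gives probability 7/20 exactly. *)

Set Implicit Arguments.
Unset Strict Implicit.
Unset Printing Implicit Defensive.
Import Order.TTheory GRing.Theory Num.Theory.
Import numFieldNormedType.Exports.
Local Open Scope classical_set_scope.
Local Open Scope ring_scope.

(** * Averages over finite stacks *)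

Section Mean.
Variable R : realFieldType.
Implicit Types (f g : seq bool -> R) (x y u v : seq bool).

(** The expectation of [f] at a stack of [n] fair hats, by conditioning on one
    hat at a time; this makes averages over concatenations immediate. *)
Fixpoint mean n f : R :=
  if n is n'.+1 then
    (mean n' (fun x => f (true :: x)) + mean n' (fun x => f (false :: x))) / 2
  else f [::].

Lemma eq_mean n f g :
  (forall x, size x = n -> f x = g x) -> mean n f = mean n g.
Proof.
elim: n f g => [|n IHn] f g fg /=; first exact: fg.
by congr ((_ + _) / 2); apply: IHn => x sx; apply: fg; rewrite /= sx.
Qed.

Lemma mean_const n (c : R) : mean n (fun=> c) = c.
Proof. by elim: n => //= n ->; field. Qed.

Lemma meanD n f g : mean n (fun x => f x + g x) = mean n f + mean n g.
Proof. by elim: n f g => //= n IHn f g; rewrite !IHn; field. Qed.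

Lemma meanZ n (c : R) f : mean n (fun x => c * f x) = c * mean n f.
Proof. by elim: n f => //= n IHn f; rewrite !IHn; field. Qed.

Lemma mean_cat m n f :
  mean (m + n) f = mean m (fun x => mean n (fun y => f (x ++ y))).
Proof. by elim: m f => //= m IHm f; rewrite !IHm. Qed.

Lemma mean_point n f y : size y = n ->
  mean n (fun x => (x == y)%:R * f x) = 2^-1 ^+ n * f y.
Proof.
move=> <-{n}; elim: y f => [|b y IHy] f /=; first by rewrite !mul1r.
have IH c : mean (size y) (fun x => (c :: x == b :: y)%:R * f (c :: x)) =
            (c == b)%:R * (2^-1 ^+ size y * f (b :: y)).
  case: (eqVneq c b) => [-> | cb].
    by rewrite mul1r -(IHy (fun x => f (b :: x))); apply: eq_mean => x _;
      rewrite eqseq_cons eqxx.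
  rewrite mul0r -[RHS](mean_const (size y)); apply: eq_mean => x _.
  by rewrite eqseq_cons (negPf cb) mul0r.
by rewrite !IH exprS; case: b {IH} => /=; field.
Qed.

Lemma mean_nth n i : (i < n)%N -> mean n (fun x => (nth false x i)%:R) = 2^-1.
Proof.
elim: n i => [|n IHn] [|i] //= lt_in; first by rewrite !mean_const; field.
by rewrite IHn //; field.
Qed.

(** Not a conditional expectation: the average is still over all stacks, and
    monochromatic ones contribute 0. *)
Definition mixed_mean n f := mean n (fun x => (~~ constant x)%:R * f x).

Lemma constant_size n x : size x = n ->
  constant x = (x == nseq n true) || (x == nseq n false).
Proof.
move=> sx; apply/(constantP false)/orP; rewrite sx.
  by case=> [[]] ->; [left | right].
by case=> /eqP ->; [exists true | exists false].
Qed.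

Lemma mean_mixed n f : (0 < n)%N ->
  mean n f = mixed_mean n f
             + 2^-1 ^+ n * (f (nseq n true) + f (nseq n false)).
Proof.
move=> n_gt0; rewrite mulrDr -!mean_point ?size_nseq // /mixed_mean -!meanD.
apply: eq_mean => x sx; rewrite (constant_size sx).
case: (eqVneq x (nseq n true)) => [->|_]; last by case: eqP => _ /=; ring.
by case: n n_gt0 {sx} => //= n _; ring.
Qed.

Lemma mean_exchange m n (f : seq bool -> seq bool -> R) :
  mean m (fun x => mean n (f x)) = mean n (fun y => mean m (f^~ y)).
Proof.
elim: m f => //= m IHm f.
by rewrite !IHm -meanD mulrC -meanZ; apply: eq_mean => x _; rewrite mulrC.
Qed.

(** * The finite game and the splicing identity *)

Definition wins (k1 k2 : seq bool -> nat) u v : bool :=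
  nth false u (k1 v) && nth false v (k2 u).

Definition win_prob n (k1 k2 : seq bool -> nat) : R :=
  mean n (fun u => mean n (fun v => (wins k1 k2 u v)%:R)).

(** Dropping [t.-1] hats of a monochromatic block leaves the block merged into a
    single hat of its colour, followed by the rest of the stack. Naming the
    merged hat amounts to naming the last hat of the other player's block,
    whose colour is that of the other merged hat when the other block is also
    monochromatic. *)
Definition splice t (k k' : seq bool -> nat) v : nat :=
  if constant (take t v) then (t.-1 + k' (drop t.-1 v))%N else k (take t v).

Lemma mixed_meanE n f : (0 < n)%N ->
  mixed_mean n f = mean n f - 2^-1 ^+ n * (f (nseq n true) + f (nseq n false)).
Proof. by move=> /mean_mixed ->; ring. Qed.

Lemma eq_mixed_mean n f g :
  (forall x, size x = n -> ~~ constant x -> f x = g x) ->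
  mixed_mean n f = mixed_mean n g.
Proof.
move=> fg; apply: eq_mean => x sx; case: (boolP (constant x)) => cx.
  by rewrite !mul0r.
by rewrite fg.
Qed.

Lemma drop_nseq_cat t (b : bool) w : (0 < t)%N ->
  drop t.-1 (nseq t b ++ w) = b :: w.
Proof. by case: t => //= t _; elim: t. Qed.

(** When one player's block is mixed and the other's is not, the former names a
    hat of index [t.-1 + q z] in a stack beginning with a mixed block. Such a
    hat is black half of the time over all stacks, hence also over those with
    a mixed first block, because on the others it is one of the [s.+1] hats
    left after merging the block. *)
Lemma mixed_mean_hat t s (q : seq bool -> nat) : (0 < t)%N ->
  (forall z, size z = s -> (q z < s.+1)%N) ->
  mixed_mean t (fun y => mean s (fun z => mean s (fun w =>
    (nth false (y ++ w) (t.-1 + q z))%:R))) = 2^-1 - 2^-1 ^+ t.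
Proof.
move=> t_gt0 q_lt; rewrite mixed_meanE // mean_exchange -meanD -meanZ.
transitivity (mean s (fun=> 2^-1 - 2^-1 ^+ t : R)); last exact: mean_const.
rewrite -[- mean _ _]mulN1r -meanZ -meanD; apply: eq_mean => z sz.
have qz := q_lt z sz; rewrite -(mean_cat t s (fun v => (nth false v (t.-1 + q z))%:R)).
rewrite mean_nth; last first.
  by rewrite -(prednK t_gt0) addSnnS ltn_add2l.
have hatE b : mean s (fun w => (nth false (nseq t b ++ w) (t.-1 + q z))%:R) =
              mean s (fun w => (nth false (b :: w) (q z))%:R).
  by apply: eq_mean => w _; rewrite -nth_drop drop_nseq_cat.
have /= Eq := mean_nth qz.
rewrite !hatE (_ : mean s _ + mean s _ = 1); first by ring.
by move: Eq; lra.
Qed.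

(** Strategies are functions on all finite stacks; only their values on stacks
    of the relevant size matter. *)
Definition legal n (k : seq bool -> nat) : Prop :=
  forall v, size v = n -> (k v < n)%N.

(** Separates the four cases according to which of the two blocks are mixed.
    Stating it for any payoff [H] that agrees with [h] on mixed blocks
    allows the same decomposition for the game on [t] hats and for the spliced
    game, which then differ only in the last term. *)
Lemma mean2_mixed t (H h : seq bool -> seq bool -> R) (c : R) : (0 < t)%N ->
  (forall x y, size x = t -> size y = t -> ~~ constant x -> ~~ constant y ->
    H x y = h x y) ->
  mixed_mean t (H (nseq t true)) = c -> mixed_mean t (H (nseq t false)) = 0 ->
  mixed_mean t (H^~ (nseq t true)) = c ->
  mixed_mean t (H^~ (nseq t false)) = 0 ->
  mean t (fun x => mean t (H x)) =
    mixed_mean t (fun x => mixed_mean t (h x)) + 2^-1 ^+ t * (c + c) +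
    2^-1 ^+ t * 2^-1 ^+ t *
      (H (nseq t true) (nseq t true) + H (nseq t true) (nseq t false) +
       H (nseq t false) (nseq t true) + H (nseq t false) (nseq t false)).
Proof.
move=> t_gt0 Hh H1 H0 H1' H0'; rewrite mean_mixed //.
rewrite !(mean_mixed (H _)) // H1 H0.
have -> : mixed_mean t (fun x => mean t (H x)) =
    mixed_mean t (fun x => mixed_mean t (h x)) + 2^-1 ^+ t * (c + 0).
  rewrite -{1}H1' -H0' /mixed_mean -meanD -meanZ -meanD.
  apply: eq_mean => x sx; rewrite mean_mixed // /mixed_mean.
  case: (boolP (constant x)) => cx; first by rewrite !mul0r; ring.
  rewrite !mul1r; congr (_ + _); apply: eq_mean => y sy.
  by case: (boolP (constant y)) => cy; rewrite ?mul0r // Hh.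
by ring.
Qed.

Lemma win_prob_mixed t k1 k2 : (0 < t)%N -> legal t k1 -> legal t k2 ->
  win_prob t k1 k2 =
    mixed_mean t (fun u => mixed_mean t (fun v => (wins k1 k2 u v)%:R))
    + 2^-1 ^+ t * (2^-1 - 2^-1 ^+ t) *+ 2 + 2^-1 ^+ t * 2^-1 ^+ t.
Proof.
move=> t_gt0 Lk1 Lk2.
have hat i : (i < t)%N ->
    mixed_mean t (fun x => (nth false x i)%:R) = 2^-1 - 2^-1 ^+ t.
  by move=> lt_it; rewrite mixed_meanE // mean_nth // !nth_nseq lt_it /=; ring.
have mono b k v : legal t k -> size v = t -> nth false (nseq t b) (k v) = b.
  by move=> Lk sv; rewrite nth_nseq Lk.
have snseq (b : bool) : size (nseq t b) = t by rewrite size_nseq.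
rewrite /win_prob.
rewrite (mean2_mixed (h := fun u v => (wins k1 k2 u v)%:R)
                     (c := 2^-1 - 2^-1 ^+ t)) //.
- by rewrite /wins !mono //=; ring.
- rewrite -(hat _ (Lk2 _ (snseq true))).
  by apply: eq_mixed_mean => v sv _; rewrite /wins mono.
- rewrite -(mean_const t 0); apply: eq_mean => v sv.
  by rewrite /wins mono //= mulr0.
- rewrite -(hat _ (Lk1 _ (snseq true))).
  by apply: eq_mixed_mean => v sv _; rewrite /wins mono // andbT.
- rewrite -(mean_const t 0); apply: eq_mean => v sv.
  by rewrite /wins mono // andbF mulr0.
Qed.

(** The 4 comes from the four pairs of monochromatic blocks, each of probability
    [2^-1 ^+ t * 2^-1 ^+ t]; the 1 is the single one of these pairs, both blocks
    black, that wins in the game on [t] hats. *)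
Theorem win_prob_splice t s k1 k2 k1' k2' : (0 < t)%N ->
  legal t k1 -> legal t k2 -> legal s.+1 k1' -> legal s.+1 k2' ->
  win_prob (t + s) (splice t k1 k1') (splice t k2 k2') =
    win_prob t k1 k2
    + 2^-1 ^+ t * 2^-1 ^+ t * (4 * win_prob s.+1 k1' k2' - 1).
Proof.
move=> t_gt0 Lk1 Lk2 Lk1' Lk2'; rewrite (win_prob_mixed _ Lk1 Lk2) // {1}/win_prob.
set K1 := splice t k1 k1'; set K2 := splice t k2 k2'.
pose H x y := mean s (fun z => mean s (fun w =>
                (wins K1 K2 (x ++ z) (y ++ w))%:R)).
have snseq (b : bool) : size (nseq t b) = t by rewrite size_nseq.
have spliceM k k' x z : size x = t -> ~~ constant x ->
    splice t k k' (x ++ z) = k x.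
  by move=> sx /negPf cx; rewrite /splice take_size_cat // cx.
have spliceC k k' b z :
    splice t k k' (nseq t b ++ z) = (t.-1 + k' (b :: z))%N.
  by rewrite /splice take_size_cat // constant_nseq drop_nseq_cat.
have hatM k x y : legal t k -> size x = t -> size y = t ->
    forall z, nth false (x ++ z) (k y) = nth false x (k y).
  by move=> Lk sx sy z; rewrite nth_cat sx Lk.
have mono b k y : legal t k -> size y = t -> nth false (nseq t b) (k y) = b.
  by move=> Lk sy; rewrite nth_nseq Lk.
have hatC b z j : nth false (nseq t b ++ z) (t.-1 + j) = nth false (b :: z) j.
  by rewrite -nth_drop drop_nseq_cat.
have -> : mean (t + s) (fun u => mean (t + s) (fun v => (wins K1 K2 u v)%:R)) =
          mean t (fun x => mean t (H x)).
  rewrite mean_cat; apply: eq_mean => x sx.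
  rewrite (eq_mean (fun z _ => mean_cat t s _)) mean_exchange.
  exact: eq_mean.
rewrite (mean2_mixed (h := fun u v => (wins k1 k2 u v)%:R)
                     (c := 2^-1 - 2^-1 ^+ t)) //.
- have HC b c : H (nseq t b) (nseq t c) =
      mean s (fun z => mean s (fun w =>
        (wins k1' k2' (b :: z) (c :: w))%:R)).
    apply: eq_mean => z sz; apply: eq_mean => w sw.
    by rewrite /wins /K1 /K2 !spliceC !hatC.
  rewrite /win_prob /=.
  have mean_half f g : mean s (fun z => (f z + g z) / 2) =
      (mean s f + mean s g) / 2.
    by rewrite -meanD mulrC -meanZ; apply: eq_mean => z _; rewrite mulrC.
  by rewrite !HC !mean_half; field.
- move=> x y sx sy cx cy.
  rewrite -[RHS](mean_const s); apply: eq_mean => z _.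
  rewrite -[RHS](mean_const s); apply: eq_mean => w _.
  by rewrite /wins /K1 /K2 !spliceM // !hatM.
- rewrite -(mixed_mean_hat (s := s) (q := fun z => k2' (true :: z)) t_gt0); last first.
    by move=> z sz; apply: Lk2'; rewrite /= sz.
  apply: eq_mixed_mean => y sy cy; apply: eq_mean => z _; apply: eq_mean => w _.
  by rewrite /wins /K1 /K2 spliceM // spliceC hatM // mono.
- rewrite -(mean_const t 0); apply: eq_mean => y sy.
  case: (boolP (constant y)) => cy; rewrite ?mul0r // mul1r.
  rewrite -(mean_const s 0); apply: eq_mean => z _.
  rewrite -(mean_const s 0); apply: eq_mean => w _.
  by rewrite /wins /K1 spliceM // hatM // mono.
- rewrite -(mixed_mean_hat (s := s) (q := fun z => k1' (true :: z)) t_gt0); last first.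
    by move=> z sz; apply: Lk1'; rewrite /= sz.
  apply: eq_mixed_mean => x sx cx; rewrite /H mean_exchange.
  apply: eq_mean => w _; apply: eq_mean => z _.
  by rewrite /wins /K1 /K2 spliceC spliceM // hatM // mono // andbT.
- rewrite -(mean_const t 0); apply: eq_mean => x sx.
  case: (boolP (constant x)) => cx; rewrite ?mul0r // mul1r.
  rewrite -(mean_const s 0); apply: eq_mean => z _.
  rewrite -(mean_const s 0); apply: eq_mean => w _.
  by rewrite /wins /K2 spliceM // (hatM k2) // mono // andbF.
Qed.

Lemma splice_legal t s k k' : (0 < t)%N -> legal t k -> legal s.+1 k' ->
  legal (t + s) (splice t k k').
Proof.
move=> t_gt0 Lk Lk' v sv; rewrite /splice; case: ifP => _.
  rewrite -(prednK t_gt0) addSnnS ltn_add2l; apply: Lk'.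
  by rewrite size_drop sv; lia.
by apply: leq_trans (leq_addr s t); apply: Lk; rewrite size_takel // sv leq_addr.
Qed.

(** With 3 hats in a circle, the black hats of a mixed stack form one arc. One
    player names the last hat of the other's arc, and the other player names the
    first hat of the former's arc. On mixed stacks this wins in 15 cases out of
    36. [find] returns 2 when neither 0 nor 1 fits, so only these are tried. *)
Definition last_black v :=
  find (fun i => nth false v i && ~~ nth false v (i.+1 %% 3)) (iota 0 2).

Definition first_black v :=
  find (fun i => nth false v i && ~~ nth false v (i.+2 %% 3)) (iota 0 2).

Lemma win_prob3 : win_prob 3 last_black first_black = 22 / 64.
Proof. by rewrite /win_prob /=; field. Qed.

(** The case [t = 1] is trivial, with winning probability 1/4, and splicing with
    the game on 3 hats adds [3/8 * (2^-1 ^+ t * 2^-1 ^+ t)] in passing from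
    [t] to [t + 2]. *)
Lemma odd_strategies t : odd t -> exists k1 k2,
  [/\ legal t k1, legal t k2 &
      win_prob t k1 k2 = 7 / 20 - 2 / 5 * (2^-1 ^+ t * 2^-1 ^+ t)].
Proof.
have find3 p : (find p (iota 0 2) < 3)%N.
  by rewrite ltnS (find_size p (iota 0 2)).
have L3 : legal 3 last_black /\ legal 3 first_black.
  by split=> v _; exact: find3.
elim/ltn_ind: t => -[|[|[|t]]] // IH odd_t.
  exists (fun=> 0%N), (fun=> 0%N); split=> //.
  by rewrite /win_prob /=; field.
have [//|/=|k1 [k2 [Lk1 Lk2 Wk]]] := IH t.+1; first by rewrite /= negbK in odd_t.
exists (splice t.+1 k1 last_black), (splice t.+1 k2 first_black).
have -> : t.+3 = (t.+1 + 2)%N by rewrite addn2.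
have [L1 L2] := L3.
split; [exact: (splice_legal (s := 2))..|].
by rewrite (win_prob_splice (s := 2)) // Wk win_prob3 exprD; field.
Qed.

End Mean.

(** * Recursive strategies and their truncations *)

Section Iteration.
Variables (t : nat) (k : seq bool -> nat).

(** The single hat beyond [n] blocks is the one named after [n]
    monochromatic blocks. *)
Fixpoint horizon n : nat := if n is n'.+1 then (t + horizon n')%N else 1%N.

(** The inner strategy skips the merged hat, hence [behead] and the
    successor. *)
Fixpoint truncated n : seq bool -> nat :=
  if n is n'.+1 then splice t k (fun v => (truncated n' (behead v)).+1)
  else fun=> 0%N.

Fixpoint stuck n (v : seq bool) : bool :=
  if n is n'.+1 then constant (take t v) && stuck n' (drop t v) else true.

Lemma legal_ignore_head s (k' : seq bool -> nat) :
  legal s k' -> legal s.+1 (fun v => (k' (behead v)).+1).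
Proof. by move=> Lk' [|b v] //= [sv]; rewrite ltnS Lk'. Qed.

Lemma truncated_legal n : (0 < t)%N -> legal t k ->
  legal (horizon n) (truncated n).
Proof.
move=> t_gt0 Lk; elim: n => [|n IHn] //=.
by apply: splice_legal => //; exact: legal_ignore_head.
Qed.

Definition skip n (s : stack) : stack := fun i => s (n + i)%N.

Lemma mkseq_skip m n (s : stack) :
  mkseq s (m + n) = mkseq s m ++ mkseq (skip m s) n.
Proof.
rewrite /mkseq iotaD map_cat; congr (_ ++ _).
by rewrite add0n -[in LHS](addn0 m) iotaDl -map_comp.
Qed.

Definition hats (s : stack) m : seq bool := mkseq (skip (m * t) s) t.

Lemma hats_skip s m : hats (skip t s) m = hats s m.+1.
Proof.
by apply: eq_mkseq => i; rewrite /skip mulSn addnA.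
Qed.

Lemma stuckP n s :
  reflect (forall j, (j < n)%N -> constant (hats s j))
          (stuck n (mkseq s (horizon n))).
Proof.
elim: n s => [|n IHn] s /=; first by left.
rewrite mkseq_skip take_size_cat ?size_mkseq // drop_size_cat ?size_mkseq //.
have -> : mkseq s t = hats s 0 by [].
apply: (iffP andP) => [[c0 /IHn c] [|j] //|c].
  by rewrite ltnS -hats_skip => /c.
split; first exact: c.
by apply/IHn => j jn; rewrite hats_skip; exact: c.
Qed.

Lemma truncatedE n s m : (0 < t)%N -> (m < n)%N ->
  (forall j, (j < m)%N -> constant (hats s j)) -> ~~ constant (hats s m) ->
  truncated n (mkseq s (horizon n)) = (m * t + k (hats s m))%N.
Proof.
move=> t_gt0; elim: n s m => [|n IHn] s m //= lt_mn first_m not_m.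
rewrite mkseq_skip /splice take_size_cat ?size_mkseq //.
have -> : mkseq s t = hats s 0 by [].
case: m => [|m] in lt_mn first_m not_m *.
  by rewrite (negPf not_m).
rewrite first_m // -drop1 drop_drop add1n prednK //.
rewrite drop_size_cat ?size_mkseq // (IHn _ m) ?hats_skip //.
  by rewrite mulSn; lia.
by move=> j jm; rewrite hats_skip; exact: first_m.
Qed.

Definition recursive (s : stack) : nat :=
  if pselect (exists m, ~~ constant (hats s m)) is left ex_m then
    let m := ex_minn ex_m in (m * t + k (hats s m))%N
  else 0%N.

Lemma recursiveE s m :
  (forall j, (j < m)%N -> constant (hats s j)) -> ~~ constant (hats s m) ->
  recursive s = (m * t + k (hats s m))%N.
Proof.
move=> first_m not_m; rewrite /recursive; case: pselect => [ex_m | []].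
  case: ex_minnP => i not_i min_i.
  suff -> : i = m by [].
  apply/eqP; rewrite eqn_leq min_i //= leqNgt; apply: contra not_i.
  exact: first_m.
by exists m.
Qed.

Lemma recursive_truncated n s : (0 < t)%N ->
  ~~ stuck n (mkseq s (horizon n)) ->
  recursive s = truncated n (mkseq s (horizon n)).
Proof.
move=> t_gt0 not_stuck.
have ex_m : exists m, (m < n)%N && ~~ constant (hats s m).
  apply: contrapT => no_m; move/negP: not_stuck; apply; apply/stuckP => j jn.
  by apply: contrapT => /negP cj; apply: no_m; exists j; rewrite jn.
case: (ex_minnP ex_m) => m /andP[lt_mn not_m] min_m.
have first_m j : (j < m)%N -> constant (hats s j).
  move=> jm; apply: contrapT => /negP cj.
  by have := min_m j; rewrite (ltn_trans jm lt_mn) cj leqNgt jm => /(_ isT).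
by rewrite (recursiveE first_m) // (truncatedE _ lt_mn first_m).
Qed.

Lemma recursive_stuck s : (forall n, stuck n (mkseq s (horizon n))) ->
  recursive s = 0%N.
Proof.
move=> all_stuck; rewrite /recursive; case: pselect => // -[m /negP[]].
exact: (stuckP m.+1 s (all_stuck m.+1)).
Qed.

End Iteration.

Section IterationProb.
Variable R : realFieldType.

Lemma win_prob_ignore_head s (k1 k2 : seq bool -> nat) :
  win_prob R s.+1 (fun v => (k1 (behead v)).+1) (fun v => (k2 (behead v)).+1) =
  win_prob R s k1 k2.
Proof.
have half (x : R) : (x + x) / 2 = x by field.
by rewrite {1}/win_prob /= half; apply: eq_mean => u _; exact: half.
Qed.

(** By [win_prob_splice], the deviation from 7/20 is multiplied by
    [4 * (2^-1 ^+ t * 2^-1 ^+ t)] at each further block; at [n = 0] the single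
    hat gives 1/4 = 7/20 - 1/10. *)
Lemma win_prob_truncated t k1 k2 n : (0 < t)%N -> legal t k1 -> legal t k2 ->
  win_prob R t k1 k2 = 7 / 20 - 2 / 5 * (2^-1 ^+ t * 2^-1 ^+ t) ->
  win_prob R (horizon t n) (truncated t k1 n) (truncated t k2 n) =
    7 / 20 - 1 / 10 * (4 * (2^-1 ^+ t * 2^-1 ^+ t)) ^+ n.
Proof.
move=> t_gt0 Lk1 Lk2 Wk; elim: n => [|n IHn].
  by rewrite /win_prob /= expr0; field.
rewrite /= win_prob_splice //; try exact/legal_ignore_head/truncated_legal.
by rewrite win_prob_ignore_head IHn Wk exprS; field.
Qed.

Lemma mean_stuck t n : (0 < t)%N ->
  mean (horizon t n) (fun v => (stuck t n v)%:R) = (2 * 2^-1 ^+ t) ^+ n :> R.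
Proof.
move=> t_gt0; elim: n => [|n IHn]; first by rewrite mean_const.
have const_t : mean t (fun x => (constant x)%:R) = 2 * 2^-1 ^+ t :> R.
  rewrite mean_mixed // !constant_nseq /mixed_mean.
  rewrite (eq_mean (g := fun=> 0)) ?mean_const /=; first by ring.
  by move=> x _; case: constant; rewrite ?mul0r ?mulr0.
rewrite /= mean_cat exprS -IHn -const_t mulrC -meanZ; apply: eq_mean => x sx.
rewrite mulrC -meanZ; apply: eq_mean => y sy.
by rewrite take_size_cat // drop_size_cat // -mulnb natrM.
Qed.

End IterationProb.

(** * Measurability and finite prefixes of the stacks *)

Section Measurability.
Context d (T : measurableType d).

Lemma measurable_preimage_countable (C : countType) (f : T -> C) (Y : set C) :
  (forall c, measurable [set w | f w = c]) -> measurable [set w | Y (f w)].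
Proof.
move=> mf; have -> : [set w | Y (f w)] =
    \bigcup_(c in [set: C]) [set w | f w = c /\ Y c].
  apply/seteqP; split=> w /=; first by exists (f w).
  by case=> c _ [] ->.
apply: countable_bigcupT_measurable => // c.
case: (pselect (Y c)) => Yc.
  by rewrite (_ : mkset _ = [set w | f w = c]) //; apply/seteqP; split=> w //= [].
by rewrite (_ : mkset _ = set0) //; apply/seteqP; split=> w //= [].
Qed.

Variable S : T -> stack.
Hypothesis mS : forall i, measurable [set w | S w i = true].

Lemma measurable_hat i b : measurable [set w | S w i = b].
Proof.
case: b => //; rewrite (_ : mkset _ = ~` [set w | S w i = true]).
  exact: measurableC.
by apply/seteqP; split=> w /=; case: (S w i).
Qed.

Lemma measurable_prefix n p : measurable [set w | mkseq (S w) n = p].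
Proof.
case: (eqVneq (size p) n) => [sp | sp]; last first.
  rewrite (_ : mkset _ = set0) //; apply/seteqP; split=> w //= E.
  by rewrite -E size_mkseq eqxx in sp.
rewrite (_ : mkset _ = \bigcap_i [set w | (i < n)%N -> S w i = nth false p i]).
  apply: bigcapT_measurable => i; case: (ltnP i n) => lt_in.
    rewrite (_ : mkset _ = [set w | S w i = nth false p i]).
      exact: measurable_hat.
    by apply/seteqP; split=> w /=; [exact | move=> ->].
  by rewrite (_ : mkset _ = setT) //; apply/seteqP; split.
apply/seteqP; split=> w /=.
  by move=> <- i _ /= lt_in; rewrite nth_mkseq.
move=> hS; apply: (@eq_from_nth _ false) => [|i]; rewrite size_mkseq ?sp //.
by move=> lt_in; rewrite nth_mkseq //; exact: hS.
Qed.

(** The answer is determined by a finite prefix as soon as some block is mixed,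
    and is 0 otherwise. *)
Lemma measurable_recursive t k (Y : set nat) : (0 < t)%N ->
  measurable [set w | Y (recursive t k (S w))].
Proof.
move=> t_gt0.
pose pre n w := mkseq (S w) (horizon t n).
have mpre n (Z : set (seq bool)) : measurable [set w | Z (pre n w)].
  by apply: measurable_preimage_countable => p; exact: measurable_prefix.
rewrite (_ : mkset _ =
  (\bigcup_n [set w | ~~ stuck t n (pre n w) /\ Y (truncated t k n (pre n w))])
  `|` (\bigcap_n [set w | stuck t n (pre n w) /\ Y 0%N])).
  apply: measurableU.
    apply: bigcupT_measurable => n.
    exact: (mpre n (fun v => ~~ stuck t n v /\ Y (truncated t k n v))).
  apply: bigcapT_measurable => n.
  exact: (mpre n (fun v => stuck t n v /\ Y 0%N)).
apply/seteqP; split=> w /=.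
  case: (pselect (exists n, ~~ stuck t n (pre n w))) => [[n not_stuck]|no_n] Yw.
    left; exists n => //=; split=> //.
    by rewrite -recursive_truncated.
  right; have all_stuck n : stuck t n (pre n w).
    by apply: contrapT => /negP not_stuck; apply: no_n; exists n.
  by rewrite recursive_stuck // in Yw.
case=> [[n _ /= [not_stuck]] | /= all_stuck].
  by rewrite -recursive_truncated.
rewrite recursive_stuck; first by case: (all_stuck 0%N I).
by move=> n; case: (all_stuck n I).
Qed.

End Measurability.

Section Prefixes.
Context d (Om : measurableType d) (R : realType) (P : probability Om R).

(** Law of total probability over the first [n] hats of [S]. Letting the event
    [E p] depend on the prefix [p] makes the induction on [n] go through and
    allows two applications in a row, for the two stacks. *)
Lemma mean_prefix n (S : Om -> stack) (E : seq bool -> set Om)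
    (h : seq bool -> R) :
  (forall i, measurable [set w | S w i = true]) ->
  (forall p, measurable (E p)) ->
  (forall p, size p = n ->
    P ([set w | mkseq (S w) n = p] `&` E p) = (2^-1 ^+ n * h p)%:E) ->
  P [set w | E (mkseq (S w) n) w] = (mean n h)%:E.
Proof.
elim: n S E h => [|n IHn] S E h mS mE PE /=.
  rewrite -[h _]mul1r -(PE [::]) //; congr (P _).
  by apply/seteqP; split=> w //= [].
have split_head w : mkseq (S w) n.+1 = S w 0%N :: mkseq (fun i => S w i.+1) n.
  by rewrite /mkseq /= -[1%N]/(1 + 0)%N iotaDl -map_comp.
pose E' b p := [set w | S w 0%N = b] `&` E (b :: p).
have mE' b p : measurable (E' b p).
  by apply: measurableI => //; exact: measurable_hat.
have IH b : P [set w | E' b (mkseq (fun i => S w i.+1) n) w] =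
             (mean n (fun p => 2^-1 * h (b :: p)))%:E.
  apply: IHn => // p sp; rewrite mulrA -exprSr -PE /= ?sp //; congr (P _).
  apply/seteqP; split=> w /=; rewrite split_head /E' /=.
    by case=> -> [-> Ew].
  by case=> [[-> ->]] Ew.
have mE'w b : measurable [set w | E' b (mkseq (fun i => S w i.+1) n) w].
  rewrite (_ : mkset _ = \bigcup_(p in [set: seq bool])
     ([set w | mkseq (fun i => S w i.+1) n = p] `&` E' b p)).
    apply: countable_bigcupT_measurable => // p; apply: measurableI => //.
    exact: (measurable_prefix (S := fun w i => S w i.+1)).
  apply/seteqP; split=> w /=.
    by move=> Ew; exists (mkseq (fun i => S w i.+1) n).
  by case=> p _ [] /= ->.
rewrite (_ : mkset _ = [set w | E' true (mkseq (fun i => S w i.+1) n) w] `|`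
                       [set w | E' false (mkseq (fun i => S w i.+1) n) w]).
  rewrite measureU //; last first.
    by apply/seteqP; split=> w //=; rewrite /E' /= => -[[-> _] []].
  rewrite mulrC mulrDr -!meanZ EFinD.
  by congr (_ + _)%E; exact: IH.
apply/seteqP; split=> w /=; rewrite split_head /E' /=.
  by case: (S w 0%N); [left | right].
by case=> -[->].
Qed.

Variables U V : nat -> {RV P >-> bool}.
Hypothesis UV : fair_hats U V.

Let su (w : Om) : stack := fun n => U n w.
Let sv (w : Om) : stack := fun n => V n w.

Lemma measurable_RV_hat (X : {RV P >-> bool}) b : measurable [set w | X w = b].
Proof.
by have := @measurable_funPTI _ _ _ _ X [set b]; apply.
Qed.

(** The only use of independence: it makes all pairs of prefixes equally
    likely. *)
Lemma prob_prefixes n m p q : size p = n -> size q = m ->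
  P ([set w | mkseq (sv w) m = q] `&` [set w | mkseq (su w) n = p]) =
  (2^-1 ^+ m * 2^-1 ^+ n)%:E.
Proof.
move=> sp sq; case: UV; set hat := fun i => _ => indep fair.
pose J : seq (nat + nat) := map inl (iota 0 n) ++ map inr (iota 0 m).
pose A (i : nat + nat) : set bool :=
  match i with inl i => [set nth false p i] | inr i => [set nth false q i] end.
have uJ : uniq J.
  rewrite cat_uniq !map_inj_uniq ?iota_uniq //=; last 2 first.
  - by move=> ? ? [].
  - by move=> ? ? [].
  by rewrite andbT; apply/hasPn => x /mapP[i _ ->]; apply/mapP => -[].
have mA i : i \in J -> measurable (A i) by [].
(* Beyond the prefixes nth is a default value, so this holds for all i. *)
have fairA i : P (hat i @^-1` A i) = (2^-1)%:E.
  rewrite -[LHS]/(distribution P (hat i) (A i)) fair /bernoulli_prob.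
  rewrite ifT; last by lra.
  by case: i => i /=; rewrite fsbig_set1 /bernoulli_pmf; case: nth => //;
    congr (_%:E); field.
(* Fixing both prefixes means prescribing the colours of the hats in J. *)
transitivity (P (\bigcap_(i in [set` J]) (hat i @^-1` A i))).
  congr (P _); apply/seteqP; split=> w /=.
    case=> Eq Ep i /=; rewrite mem_cat => /orP[] /mapP[j].
      by rewrite mem_iota => /andP[_ lt_j] -> /=; rewrite -Ep nth_mkseq.
    by rewrite mem_iota => /andP[_ lt_j] -> /=; rewrite -Eq nth_mkseq.
  move=> Jw; split; apply: (@eq_from_nth _ false) => [|i]; rewrite size_mkseq //.
    move=> lt_i; rewrite nth_mkseq //; apply: (Jw (inr i)).
    by rewrite /= mem_cat map_f ?orbT // mem_iota.
  move=> lt_i; rewrite nth_mkseq //; apply: (Jw (inl i)).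
  by rewrite /= mem_cat map_f // mem_iota.
rewrite indep // (eq_bigr (fun=> (2^-1)%:E)) // prodEFin; congr (_%:E).
rewrite big_const_seq count_predT iter_mulr_1 size_cat !size_map !size_iota.
by rewrite exprD mulrC.
Qed.

Lemma prob_determined n (g : seq bool -> seq bool -> bool) :
  P [set w | g (mkseq (su w) n) (mkseq (sv w) n)] =
  (mean n (fun u => mean n (fun v => (g u v)%:R)))%:E.
Proof.
have mu i : measurable [set w | su w i = true] by exact: measurable_RV_hat.
have mv i : measurable [set w | sv w i = true] by exact: measurable_RV_hat.
have mg p : measurable [set w | g p (mkseq (sv w) n)].
  apply: (measurable_preimage_countable (fun q => g p q)) => q.
  exact: measurable_prefix.
apply: (mean_prefix (S := su) (E := fun p => [set w | g p (mkseq (sv w) n)])) => //.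
move=> p sp.
rewrite -meanZ -(mean_prefix (S := sv) (E := fun q =>
  [set w | mkseq (su w) n = p] `&` [set w | g p q])
  (h := fun q => 2^-1 ^+ n * (g p q)%:R)) //.
- move=> q; apply: measurableI; first exact: measurable_prefix.
  by case: (g p q); [rewrite (_ : mkset _ = setT) | rewrite (_ : mkset _ = set0)];
    rewrite //; apply/seteqP; split.
- move=> q sq; rewrite setIA mulrA; case: (g p q).
    rewrite mulr1 -(prob_prefixes sp sq); congr (P _).
    by apply/seteqP; split=> w //= [].
  rewrite mulr0 (_ : _ `&` _ = set0) ?measure0 //.
  by apply/seteqP; split=> w //= [].
Qed.

End Prefixes.

(** * The probability of victory *)

Section Victory.
Context d (Om : measurableType d) (R : realType) (P : probability Om R).
Variables U V : nat -> {RV P >-> bool}.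
Hypothesis UV : fair_hats U V.

Let su (w : Om) : stack := fun n => U n w.
Let sv (w : Om) : stack := fun n => V n w.

Variables (t : nat) (k1 k2 : seq bool -> nat).
Hypotheses (t_gt0 : (0 < t)%N) (Lk1 : legal t k1) (Lk2 : legal t k2).

Lemma measurable_victory :
  measurable (victory U V (recursive t k1) (recursive t k2)).
Proof.
have mu i : measurable [set w | su w i = true] by exact: measurable_RV_hat.
have mv i : measurable [set w | sv w i = true] by exact: measurable_RV_hat.
rewrite (_ : victory _ _ _ _ = \bigcup_(ij in [set: nat * nat])
  (([set w | recursive t k1 (sv w) = ij.1] `&`
    [set w | recursive t k2 (su w) = ij.2]) `&`
   ([set w | su w ij.1 = true] `&` [set w | sv w ij.2 = true]))).
  apply: countable_bigcupT_measurable => // -[i j] /=.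
  apply: measurableI; last exact: measurableI.
  apply: measurableI.
    exact: (measurable_recursive mv k1 (fun l => l = i)).
  exact: (measurable_recursive mu k2 (fun l => l = j)).
apply/seteqP; split=> w /=; last first.
  by case=> -[i j] _ [] [/= <- <-].
by move=> vw; exists (recursive t k1 (sv w), recursive t k2 (su w)).
Qed.

Lemma victory_truncated n w :
  ~~ stuck t n (mkseq (su w) (horizon t n)) ->
  ~~ stuck t n (mkseq (sv w) (horizon t n)) ->
  victory U V (recursive t k1) (recursive t k2) w <->
  wins (truncated t k1 n) (truncated t k2 n)
    (mkseq (su w) (horizon t n)) (mkseq (sv w) (horizon t n)).
Proof.
move=> not_u not_v; rewrite /wins /victory /=.
rewrite (recursive_truncated k1 t_gt0 not_v).
rewrite (recursive_truncated k2 t_gt0 not_u).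
rewrite !nth_mkseq; try by apply: truncated_legal => //; rewrite size_mkseq.
by split=> [[Uw Vw]|/andP[]//]; apply/andP; split.
Qed.

(** The right-hand side bounds the probability that the first [n] blocks of one
    of the stacks are all monochromatic. Otherwise both strategies agree with
    their truncations, whose outcome depends on finitely many hats. *)
Lemma victory_approx n :
  `|fine (P (victory U V (recursive t k1) (recursive t k2))) -
    win_prob R (horizon t n) (truncated t k1 n) (truncated t k2 n)|
  <= 2 * (2 * 2^-1 ^+ t) ^+ n.
Proof.
set W := victory _ _ _ _; set N := horizon t n.
pose En := [set w | wins (truncated t k1 n) (truncated t k2 n)
                      (mkseq (su w) N) (mkseq (sv w) N)].
pose Du := [set w | stuck t n (mkseq (su w) N)].
pose Dv := [set w | stuck t n (mkseq (sv w) N)].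
have mu i : measurable [set w | su w i = true] by exact: measurable_RV_hat.
have mv i : measurable [set w | sv w i = true] by exact: measurable_RV_hat.
have mDu : measurable Du.
  apply: (measurable_preimage_countable (f := fun w => mkseq (su w) N)
    (stuck t n)) => p.
  exact: measurable_prefix.
have mDv : measurable Dv.
  apply: (measurable_preimage_countable (f := fun w => mkseq (sv w) N)
    (stuck t n)) => p.
  exact: measurable_prefix.
have mW : measurable W by exact: measurable_victory.
have mEn : measurable En.
  apply: (measurable_preimage_countable
    (f := fun w => (mkseq (su w) N, mkseq (sv w) N))
    (fun uv => wins (truncated t k1 n) (truncated t k2 n) uv.1 uv.2)).
  move=> [p q].
  rewrite (_ : mkset _ = [set w | mkseq (su w) N = p] `&`
                         [set w | mkseq (sv w) N = q]).
    by apply: measurableI; exact: measurable_prefix.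
  by apply/seteqP; split=> w /= [-> ->].
have PE : P En = (win_prob R N (truncated t k1 n) (truncated t k2 n))%:E.
  exact: (prob_determined UV).
have PDu : P Du = ((2 * 2^-1 ^+ t) ^+ n)%:E.
  rewrite -(mean_stuck R n t_gt0) (prob_determined UV N (fun u _ => stuck t n u)).
  by congr (_%:E); apply: eq_mean => u _; rewrite mean_const.
have PDv : P Dv = ((2 * 2^-1 ^+ t) ^+ n)%:E.
  rewrite -(mean_stuck R n t_gt0) (prob_determined UV N (fun _ v => stuck t n v)).
  by rewrite mean_const.
have [p PW] : exists p, P W = p%:E.
  by exists (fine (P W)); rewrite fineK // fin_num_measure.
rewrite PW /=.
have cover A B : measurable A -> measurable B ->
    (forall w, ~ (Du `|` Dv) w -> A w -> B w) ->
    (P A <= P B + (P Du + P Dv))%E.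
  move=> mA mB AB.
  have {}AB : A `<=` B `|` (Du `|` Dv).
    by move=> w Aw; have [Dw|/AB] := pselect ((Du `|` Dv) w); [right | left; auto].
  have mD : measurable (Du `|` Dv) by exact: measurableU.
  have : (P A <= P (B `|` (Du `|` Dv)))%E.
    by apply: le_measure => //; rewrite inE //; exact: measurableU.
  move/le_trans; apply; apply: (le_trans (measureU2 _ _ _)) => //.
  by apply: leeD => //; exact: measureU2.
have undecided w : ~ (Du `|` Dv) w -> W w <-> En w.
  move=> not_stuck; apply: victory_truncated; apply/negP => st; apply: not_stuck.
    by left.
  by right.
have := cover W En mW mEn (fun w Dw => (undecided w Dw).1).
have := cover En W mEn mW (fun w Dw => (undecided w Dw).2).
rewrite PE PDu PDv PW -!EFinD !lee_fin.
set f := win_prob _ _ _ _; set x := _ ^+ n => le1 le2.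
by rewrite ler_norml; apply/andP; split; lra.
Qed.

End Victory.

Lemma eq_of_geometric_bound (R : realType) (x y c q : R) : 0 <= q < 1 ->
  (forall n, `|x - y| <= c * q ^+ n) -> x = y.
Proof.
move=> /andP[q0 q1] bound; apply/eqP; rewrite -subr_eq0 -normr_le0.
have : (fun n => c * q ^+ n) @ \oo --> c * 0.
  by apply: cvgMr; apply: cvg_expr; rewrite ger0_norm.
rewrite mulr0 => /cvgr_to_ge; apply.
by near=> n; exact: bound.
Unshelve. all: by end_near.
Qed.

Lemma val_block t s m : tval (block t s m) = hats t s m.
Proof.
rewrite /hats /mkseq -val_enum_ord -map_comp /=.
by apply: eq_map => i.
Qed.

Lemma monochromaticE t (u : t.-tuple bool) : monochromatic u = constant u.
Proof.
by rewrite /monochromatic (constant_size (size_tuple u)) -!val_eqE orbC.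
Qed.

Lemma measurable_strategy_recursive t k : (0 < t)%N ->
  measurable_strategy (recursive t k).
Proof.
move=> t_gt0 _ Y _; rewrite setTI.
apply: (@measurable_recursive _ (g_sigma_algebraType cylinder) id) => // i.
by apply: sub_sigma_algebra; exists i, true.
Qed.

Lemma recursive_strategy_recursive t k (Lk : legal t k) :
  recursive_strategy (fun v : t.-tuple bool => Ordinal (Lk v (size_tuple v)))
    (recursive t k).
Proof.
move=> s m first_m not_m; rewrite (@recursiveE t k s m) /= ?val_block //.
  by move=> j /first_m; rewrite monochromaticE val_block.
by move: not_m; rewrite monochromaticE val_block.
Qed.

Theorem theorem26 (R : realType) (t : nat) (ht : (3 <= t)%N) (hodd : odd t) :
  exists K1 K2 : strategy, R_type R t K1 K2.
Proof.
have t_gt0 : (0 < t)%N by exact: leq_trans ht.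
have [k1 [k2 [Lk1 Lk2 Wk]]] := odd_strategies R hodd.
exists (recursive t k1), (recursive t k2); split.
- exact: measurable_strategy_recursive.
- exact: measurable_strategy_recursive.
- by do 2!eexists; split; exact: recursive_strategy_recursive.
move=> d Om P U V UV; set W := victory _ _ _ _.
rewrite -(@fineK _ (P W)) ?fin_num_measure //; last exact: measurable_victory.
congr (_%:E).
have small : 0 <= (2^-1 ^+ t : R) <= 8^-1.
  apply/andP; split; first by rewrite exprn_ge0 ?invr_ge0.
  have -> : 8^-1 = 2^-1 ^+ 3 :> R by field.
  by apply: ler_wiXn2l => //; lra.
apply: (@eq_of_geometric_bound _ _ _ 3 (2 * 2^-1 ^+ t)); first by lra.
move=> n; have := victory_approx UV t_gt0 Lk1 Lk2 n.
rewrite (win_prob_truncated n t_gt0 Lk1 Lk2 Wk) -/W.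
set x := 2^-1 ^+ t in small *.
have : (4 * (x * x)) ^+ n <= (2 * x) ^+ n by apply: lerXn2r; rewrite ?nnegrE; nra.
have : 0 <= (4 * (x * x)) ^+ n by apply: exprn_ge0; nra.
by rewrite !ler_norml; lra.
Qed.
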